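(* Let $(X,\mu)$ be a measure space with $\sigma$-finite measure $\mu$, let $\psi:X\rightarrow X$ be a measurable function such that the linear map $f(x)\mapsto f(\psi(x))$ induces a bounded linear operator on $L^{2}(X,\mu)$, and let $\xi\in L^{\infty}(X,\mu)$. Then the operator $$T: f\in L^{2}(X,\mu)\mapsto \xi(x)f(\psi(x))$$ on $L^2(X,\mu)$ is half-centered.
   Context: A bounded operator $T$ on a Hilbert space is half-centered if the operators $T^{*}T,T^{*2}T^{2},T^{*3}T^{3},\dots$ mutually commute. $L^2(X,\mu)$ is the complex Hilbert space of square-integrable functions. *)

(* Defs.v *)
From HB Require Import structures.
From mathcomp Require Import all_boot all_order all_algebra.
From mathcomp Require Import generic_quotient ring_quotient sesquilinear complex.
From mathcomp Require Import all_classical all_reals all_analysis.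
From mathcomp Require Import measurable_realfun.

Set Implicit Arguments.
Unset Strict Implicit.
Unset Printing Implicit Defensive.

Import Order.TTheory GRing.Theory Num.Theory.
Import numFieldNormedType.Exports Normc.

Local Open Scope classical_set_scope.
Local Open Scope complex_scope.
Local Open Scope quotient_scope.
Local Open Scope ring_scope.

(* Operators on an inner product space. The form is linear in its first argument
   and the norm of u is sqrtC '[u, u]. *)
Section operators.
Context {C : numClosedFieldType} {U : lmodType C}.
Variable form : {dot U for (@Num.conj C)}.
Local Notation "''[' u , v ]" := (form u v) : ring_scope.

Definition bounded_op (T : U -> U) : Prop :=
  exists M : C, forall u, sqrtC '[T u, T u] <= M * sqrtC '[u, u].

Definition is_adjoint (T S : U -> U) : Prop :=
  forall u v, '[T u, v] = '[u, S v].

(* An adjoint is unique when it exists, and every bounded operator on a Hilbert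
   space has one; its existence is part of the assertion. *)
Definition half_centered (T : {linear U -> U}) : Prop :=
  bounded_op T /\
  exists S : {linear U -> U}, is_adjoint T S /\
    forall m n, (0 < m)%N -> (0 < n)%N ->
      (iter m S \o iter m T) \o (iter n S \o iter n T) =1
      (iter n S \o iter n T) \o (iter m S \o iter m T).

End operators.

Section complex_Lp_functions.
Context {d : measure_display} {X : measurableType d} {R : realType}.
Variable mu : {measure set X -> \bar R}.
Implicit Types f g : X -> R[i].

Definition cmeasurable f : Prop :=
  measurable_fun setT (@complex.Re R \o f) /\ measurable_fun setT (@complex.Im R \o f).

(* Complex-valued functions with finite L^p norm, before identification of
   functions that agree almost everywhere; for p = +oo, the essentially bounded
   ones. *)
Definition cLfun (p : \bar R) : {pred X -> R[i]} :=
  mem [set f | cmeasurable f /\ finite_norm mu p (@normc R \o f)].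

Lemma cLfunP p f : f \in cLfun p <->
  cmeasurable f /\ finite_norm mu p (@normc R \o f).
Proof. by rewrite inE. Qed.

Lemma cmeasurableD f g : cmeasurable f -> cmeasurable g -> cmeasurable (f + g).
Proof.
move=> [f1 f2] [g1 g2]; split.
  rewrite (_ : _ \o _ = (@complex.Re R \o f) \+ (@complex.Re R \o g)).
    exact: measurable_funD.
  by apply/funext => x /=; rewrite fctE; case: (f x) (g x) => ? ? [? ?].
rewrite (_ : _ \o _ = (@complex.Im R \o f) \+ (@complex.Im R \o g)).
  exact: measurable_funD.
by apply/funext => x /=; rewrite fctE; case: (f x) (g x) => ? ? [? ?].
Qed.

Lemma cmeasurableM f g : cmeasurable f -> cmeasurable g ->
  cmeasurable (fun x => f x * g x).
Proof.
move=> [f1 f2] [g1 g2]; split.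
  rewrite (_ : _ \o _ = ((@complex.Re R \o f) \* (@complex.Re R \o g)) \-
                        ((@complex.Im R \o f) \* (@complex.Im R \o g))).
    by apply: measurable_funB; exact: measurable_funM.
  by apply/funext => x /=; case: (f x) (g x) => ? ? [? ?].
rewrite (_ : _ \o _ = ((@complex.Re R \o f) \* (@complex.Im R \o g)) \+
                      ((@complex.Im R \o f) \* (@complex.Re R \o g))).
  by apply: measurable_funD; exact: measurable_funM.
by apply/funext => x /=; case: (f x) (g x) => ? ? [? ?].
Qed.

Lemma cmeasurable_conj f : cmeasurable f -> cmeasurable (fun x => (f x)^*%C).
Proof.
move=> [f1 f2]; split.
  by rewrite (_ : _ \o _ = @complex.Re R \o f)//; apply/funext => x /=; case: (f x).
rewrite (_ : _ \o _ = \- (@complex.Im R \o f)); first exact: measurable_funN.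
by apply/funext => x /=; case: (f x).
Qed.

Lemma cmeasurable_cst (a : R[i]) : cmeasurable (cst a).
Proof. by split; exact: measurable_cst. Qed.

Lemma normcE2 (z : R[i]) : normc z = Num.sqrt (complex.Re z ^+ 2 + complex.Im z ^+ 2).
Proof. by case: z. Qed.

Lemma measurable_normc f : cmeasurable f -> measurable_fun setT (@normc R \o f).
Proof.
move=> [f1 f2].
rewrite (_ : _ \o _ = fun x => Num.sqrt
    (((@complex.Re R \o f) x) ^+ 2 + ((@complex.Im R \o f) x) ^+ 2)); last first.
  by apply/funext => x /=; exact: normcE2.
apply: (@measurableT_comp _ _ _ _ _ _ (@Num.sqrt R)).
  exact: (continuous_measurable_fun (@sqrt_continuous R)).
by apply: measurable_funD; exact: measurable_funX.
Qed.

Lemma normc_ge0 (z : R[i]) : 0 <= normc z.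
Proof. by rewrite normcE2 sqrtr_ge0. Qed.

Lemma finite_norm2_le (f g : X -> R) : measurable_fun setT f ->
  measurable_fun setT g -> (forall x, `|f x| <= `|g x|) ->
  finite_norm mu 2 g -> finite_norm mu 2 f.
Proof.
move=> mf mg fg; rewrite /finite_norm; apply: le_lt_trans.
rewrite unlock gt0_ler_poweR//.
- by rewrite in_itv/= leey integral_ge0.
- by rewrite in_itv/= leey integral_ge0.
- apply: ge0_le_integral => //.
  + by move=> x _; exact: poweR_ge0.
  + apply: (measurableT_comp (measurable_poweR _)) => //.
    by apply: measurableT_comp => //; exact/measurable_EFinP.
  + apply: (measurableT_comp (measurable_poweR _)) => //.
    by apply: measurableT_comp => //; exact/measurable_EFinP.
  + move=> x _; apply: gt0_ler_poweR; rewrite ?in_itv/= ?leey ?andbT ?lee_fin//.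
Qed.

Lemma cLfun2_submod_closed : submod_closed (cLfun 2).
Proof.
split.
  apply/cLfunP; split; first exact: (cmeasurable_cst 0).
  rewrite (_ : _ \o _ = cst 0); first exact: (@finite_norm_cst0 _ _ _ mu _ (lee1n 2)).
  by apply/funext => x; exact: normc0.
move=> a f g /cLfunP[mf ff] /cLfunP[mg fg]; apply/cLfunP.
have maf : cmeasurable (a *: f) by apply: cmeasurableM => //; exact: cmeasurable_cst.
have mafg := cmeasurableD maf mg.
split => //.
have mnf := measurable_normc mf; have mng := measurable_normc mg.
have Lf : (@normc R \o f) \in Lfun mu 2%:E.
  by rewrite inE; apply/andP; split; rewrite inE.
have Lg : (@normc R \o g) \in Lfun mu 2%:E.
  by rewrite inE; apply/andP; split; rewrite inE.
have Laf : normc a \o* (@normc R \o f) \in Lfun mu 2%:E.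
  by apply: Lfun_scale => //; rewrite ler1n.
have := Lfun_addr_closed mu (lee1n 2) => -[_ /(_ _ _ Laf Lg)].
rewrite inE => /andP[]; rewrite !inE => msum fsum.
apply: finite_norm2_le fsum => //; first exact: measurable_normc.
move=> x; rewrite /= !fctE /= !ger0_norm ?addr_ge0 ?mulr_ge0 ?normc_ge0//.
by rewrite (le_trans (le_normcD _ _))// lerD2r normcM mulrC.
Qed.

HB.instance Definition _ := GRing.isSubmodClosed.Build _ _ (cLfun 2)
  cLfun2_submod_closed.

Record L2fun := MkL2fun {
  L2fun_val :> X -> R[i];
  L2funP : L2fun_val \in cLfun 2 }.

HB.instance Definition _ := [isSub for L2fun_val].
HB.instance Definition _ := [Choice of L2fun by <:].
HB.instance Definition _ := [SubChoice_isSubLmodule of L2fun by <:].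

Definition null_L2fun : {pred L2fun} :=
  mem [set f : L2fun | (f : X -> R[i]) = cst 0 %[ae mu]].

End complex_Lp_functions.

Section L2_module.
Context {d : measure_display} {X : measurableType d} {R : realType}.
Variable mu : {measure set X -> \bar R}.

Lemma null_L2fun_zmod_closed : zmod_closed (null_L2fun (mu := mu)).
Proof.
split; first by rewrite inE /=; exact: ae_eq_refl.
move=> f g; rewrite !inE /= => f0 g0.
apply: filterS2 f0 g0 => x /(_ Logic.I) fx /(_ Logic.I) gx _.
by rewrite -[LHS]/(f x - g x) fx gx subrr.
Qed.

HB.instance Definition _ := GRing.isZmodClosed.Build _ (null_L2fun (mu := mu))
  null_L2fun_zmod_closed.

Definition L2 : Type := {ideal_quot (null_L2fun (mu := mu))}.

HB.instance Definition _ := GRing.Zmodule.on L2.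
HB.instance Definition _ := EqQuotient.on L2.

Lemma eqL2P (f g : L2fun mu) :
  \pi_L2 f = \pi_L2 g <-> (f : X -> R[i]) = g %[ae mu].
Proof.
have -> : (\pi_L2 f = \pi_L2 g) <-> (f - g \in null_L2fun (mu := mu)).
  rewrite Quotient.idealrBE; split => [->|/eqP//]; exact: eqxx.
rewrite inE /=; split; apply: filterS => x /(_ Logic.I) fx _.
  by move: fx => /eqP; rewrite -[X in X == _]/(f x - g x) subr_eq0 => /eqP.
by rewrite -[LHS]/(f x - g x) fx subrr.
Qed.

Lemma repr_L2 (f : L2fun mu) : (repr (\pi_L2 f) : X -> R[i]) = f %[ae mu].
Proof. by apply/eqL2P; rewrite reprK. Qed.

Definition scaleL2 (a : R[i]) (u : L2) : L2 := \pi_L2 (a *: repr u).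

Lemma scaleL2E a f : scaleL2 a (\pi_L2 f) = \pi_L2 (a *: f).
Proof.
apply/eqL2P; apply: filterS (repr_L2 f) => x /(_ Logic.I) fx _.
by rewrite -[LHS]/(a * (repr (\pi_L2 f) : L2fun mu) x) fx.
Qed.

Lemma addL2E f g : \pi_L2 f + \pi_L2 g = \pi_L2 (f + g).
Proof. by rewrite raddfD. Qed.

Let scaleL2A a b u : scaleL2 a (scaleL2 b u) = scaleL2 (a * b) u.
Proof. by rewrite -[u]reprK (scaleL2E b) !scaleL2E scalerA. Qed.

Let scale1L2 : left_id 1 scaleL2.
Proof. by move=> u; rewrite -[u]reprK scaleL2E scale1r. Qed.

Let scaleL2Dr : right_distributive scaleL2 +%R.
Proof.
by move=> a u v; rewrite -[u]reprK -[v]reprK addL2E !scaleL2E addL2E scalerDr.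
Qed.

Let scaleL2Dl u : {morph scaleL2^~ u : a b / a + b}.
Proof. by move=> a b; rewrite -[u]reprK !scaleL2E addL2E scalerDl. Qed.

HB.instance Definition _ := GRing.Zmodule_isLmodule.Build R[i] L2
  scaleL2A scale1L2 scaleL2Dr scaleL2Dl.

End L2_module.

Section L2_inner_product.
Context {d : measure_display} {X : measurableType d} {R : realType}.
Variable mu : {measure set X -> \bar R}.

Definition cintegral (f : X -> R[i]) : R[i] :=
  (\int[mu]_x complex.Re (f x))%R +i* (\int[mu]_x complex.Im (f x))%R.

Definition cintegrable (f : X -> R[i]) : Prop :=
  mu.-integrable setT (EFin \o (@complex.Re R \o f)) /\
  mu.-integrable setT (EFin \o (@complex.Im R \o f)).

Lemma L2fun_measurable (f : L2fun mu) : cmeasurable f.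
Proof. by case/cLfunP: (L2funP f). Qed.

Lemma L2fun_Re_Im (f : L2fun mu) :
  (@complex.Re R \o f) \in Lfun mu 2%:E /\ (@complex.Im R \o f) \in Lfun mu 2%:E.
Proof.
case/cLfunP: (L2funP f) => mf nf; case: (mf) => f1 f2.
have mnf := measurable_normc mf.
by split; rewrite inE; apply/andP; split; rewrite inE//=;
  apply: finite_norm2_le nf => // x /=; rewrite [leRHS]ger0_norm ?normc_ge0// normcE2;
  rewrite -[leLHS]sqrtr_sqr ler_wsqrtr// ?lerDl ?lerDr sqr_ge0.
Qed.

Lemma cintegrable_mul_conj (f g : L2fun mu) :
  cintegrable (fun x => f x * (g x)^*%C).
Proof.
have [f1 f2] := L2fun_Re_Im f; have [g1 g2] := L2fun_Re_Im g.
have I u v (Lu : u \in Lfun mu 2%:E) (Lv : v \in Lfun mu 2%:E) :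
    mu.-integrable setT (EFin \o (u \* v)).
  exact/Lfun1_integrable/Lfun2_mul_Lfun1.
split.
  rewrite (_ : _ \o _ =
      ((EFin \o ((@complex.Re R \o f) \* (@complex.Re R \o g))%R) \+
       (EFin \o ((@complex.Im R \o f) \* (@complex.Im R \o g))%R))%E).
    by apply: integrableD => //; exact: I.
  apply/funext => x /=; case: (f x) (g x) => ? ? [? ?] /=.
  by rewrite mulrN opprK EFinD.
rewrite (_ : _ \o _ =
    ((EFin \o ((@complex.Im R \o f) \* (@complex.Re R \o g))%R) \-
     (EFin \o ((@complex.Re R \o f) \* (@complex.Im R \o g))%R))%E).
  by apply: integrableB => //; exact: I.
apply/funext => x /=; case: (f x) (g x) => ? ? [? ?] /=.
by rewrite mulrN addrC EFinB.
Qed.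

Lemma cintegralD f g : cintegrable f -> cintegrable g ->
  cintegral (fun x => f x + g x) = cintegral f + cintegral g.
Proof.
move=> [f1 f2] [g1 g2]; rewrite /cintegral.
rewrite -[RHS]/((_ + _) +i* (_ + _)) -!RintegralD//.
by congr (_ +i* _); apply: eq_Rintegral => x _; case: (f x) (g x) => ? ? [? ?].
Qed.

Lemma cintegralZ a f : cintegrable f ->
  cintegral (fun x => a * f x) = a * cintegral f.
Proof.
move=> [f1 f2]; rewrite /cintegral; case: a => a b.
have iZ (c : R) h : mu.-integrable setT (EFin \o h) ->
    mu.-integrable setT (EFin \o (fun x => c * h x)).
  by move=> ih; exact: (@integrableZl _ _ _ mu _ measurableT c _ ih).
rewrite -[RHS]/((_ - _) +i* (_ + _)) -!RintegralZl//.
rewrite -RintegralB ?iZ// -RintegralD ?iZ//.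
by congr (_ +i* _); apply: eq_Rintegral => x _; case: (f x) => ? ?.
Qed.

Lemma cintegral_conj f : cintegrable f ->
  cintegral (fun x => (f x)^*%C) = (cintegral f)^*%C.
Proof.
move=> [f1 f2]; rewrite /cintegral -[RHS]/(_ +i* (- _)) -mulN1r -RintegralZl//.
congr (_ +i* _); apply: eq_Rintegral => x _; first by case: (f x).
by case: (f x) => ? ?; rewrite mulN1r.
Qed.

Lemma ae_eq_cintegral f g : cmeasurable f -> cmeasurable g ->
  f = g %[ae mu] -> cintegral f = cintegral g.
Proof.
move=> [f1 f2] [g1 g2] fg; rewrite /cintegral /Rintegral.
congr (fine _ +i* fine _); apply: ae_eq_integral => //;
  by [exact/measurable_EFinP|apply: filterS fg => x /[apply] ->].
Qed.

Definition dotL2 (u v : L2 mu) : R[i] :=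
  cintegral (fun x => repr u x * (repr v x)^*%C).

Lemma dotL2E (f g : L2fun mu) :
  dotL2 (\pi_(L2 mu) f) (\pi_(L2 mu) g) = cintegral (fun x => f x * (g x)^*%C).
Proof.
apply: ae_eq_cintegral.
- apply: cmeasurableM; first exact: L2fun_measurable.
  exact/cmeasurable_conj/L2fun_measurable.
- apply: cmeasurableM; first exact: L2fun_measurable.
  exact/cmeasurable_conj/L2fun_measurable.
- apply: filterS2 (repr_L2 f) (repr_L2 g) => x /(_ Logic.I) fx /(_ Logic.I) gx _.
  by rewrite fx gx.
Qed.

Lemma dotL2_conj u v : dotL2 u v = (dotL2 v u)^*%C.
Proof.
rewrite /dotL2 -cintegral_conj; last exact: cintegrable_mul_conj.
by congr cintegral; apply/funext => x; rewrite rmorphM/= conjcK mulrC.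
Qed.

Lemma dotL2_linearl w : linear_for *%R (dotL2^~ w).
Proof.
move=> a u v; rewrite -[u]reprK -[v]reprK -[w]reprK.
rewrite [_ *: _]scaleL2E addL2E !dotL2E -cintegralZ; last exact: cintegrable_mul_conj.
have I1 := cintegrable_mul_conj (a *: repr u) (repr w).
have I2 := cintegrable_mul_conj (repr v) (repr w).
transitivity (cintegral (fun x =>
    (a *: repr u : L2fun mu) x * (repr w x)^*%C + repr v x * (repr w x)^*%C)).
  by congr cintegral; apply/funext => x; rewrite -mulrDl.
rewrite cintegralD//; congr (_ + _); congr cintegral; apply/funext => x.
by rewrite mulrA.
Qed.

Lemma dotL2_bilinear :
  bilinear_for *%R ((@Num.conj R[i]) \; *%R) dotL2.
Proof.
split=> [|w a u v]; first exact: dotL2_linearl.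
rewrite dotL2_conj dotL2_linearl rmorphD rmorphM/=.
by rewrite (dotL2_conj w u) (dotL2_conj w v).
Qed.

HB.instance Definition _ :=
  bilinear_isBilinear.Build R[i] (L2 mu) (L2 mu) R[i] _ _ dotL2 dotL2_bilinear.

Let dotL2_hermitian u v :
  dotL2 u v = (-1) ^+ false * (@Num.conj R[i]) (dotL2 v u).
Proof. by rewrite expr0 mul1r dotL2_conj. Qed.

HB.instance Definition _ :=
  isHermitianSesquilinear.Build R[i] (L2 mu) false (@Num.conj R[i]) dotL2
    dotL2_hermitian.

Lemma dotL2_gt0 u : u != 0 -> 0 < dotL2 u u.
Proof.
move=> u0; pose f := repr u.
have -> : dotL2 u u = (\int[mu]_x (normc (f x) ^+ 2))%:C.
  rewrite /dotL2 /cintegral; congr (_ +i* _).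
    apply: eq_Rintegral => x _; rewrite -/f normcE2.
    rewrite sqr_sqrtr ?addr_ge0 ?sqr_ge0//.
    by case: (f x) => a b /=; rewrite mulrN opprK !expr2.
  rewrite (_ : \int[mu]_x _ = \int[mu]_x 0); first by rewrite Rintegral_cst// mul0r.
  apply: eq_Rintegral => x _; rewrite -/f.
  by case: (f x) => a b /=; rewrite mulrN mulrC addNr.
rewrite ltcR lt0r Rintegral_ge0 ?andbT; last by move=> x _; exact: sqr_ge0.
apply: contra u0 => /eqP I0.
have [mf nf] := (cLfunP _ _ _).1 (L2funP f).
have mnf := measurable_normc mf.
have Lnf : (@normc R \o f) \in Lfun mu 2%:E by rewrite inE; apply/andP; split; rewrite inE.
have iN := Lfun2_integrable_sqr Lnf.
have I0' : (\int[mu]_x `|((normc (f x)) ^+ 2)%:E| = 0)%E.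
  rewrite (eq_integral (fun x => ((normc (f x)) ^+ 2)%:E)); last first.
    by move=> x _; rewrite gee0_abs// lee_fin sqr_ge0.
  by rewrite -[LHS]fineK ?integrable_fin_num//; rewrite /Rintegral in I0; rewrite I0.
have ms : measurable_fun setT (fun x => ((normc (f x)) ^+ 2)%:E).
  by apply/measurable_EFinP; exact: (measurable_funX 2 mnf).
move/(ae_eq_integral_abs mu measurableT ms) : I0' => fae.
have -> : 0 = \pi_(L2 mu) 0.
  by apply: (addrI (\pi_(L2 mu) 0)); rewrite addL2E !addr0.
rewrite -[u]reprK; apply/eqP/eqL2P; apply: filterS fae => x /[apply] /eqP.
by rewrite eqe sqrf_eq0 => /eqP /eq0_normc.
Qed.

HB.instance Definition _ := isDotProduct.Build R[i] (L2 mu) dotL2 dotL2_gt0.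

End L2_inner_product.

Arguments dotL2 {d X R} mu u v.

(* A map w on functions induces the operator T on classes when w preserves
   square-integrability and T [f] = [w f] for every square-integrable f; in
   particular w then respects almost-everywhere equality. *)
Definition induces {d : measure_display} {X : measurableType d} {R : realType}
    {mu : {measure set X -> \bar R}} (w : (X -> R[i]) -> (X -> R[i]))
    (T : L2 mu -> L2 mu) : Prop :=
  forall f : L2fun mu, exists2 g : L2fun mu,
    (g : X -> R[i]) = w f & T (\pi_(L2 mu) f) = \pi_(L2 mu) g.

(* Main.v *)
Require Import Defs.
From HB Require Import structures.
From mathcomp Require Import all_boot all_order all_algebra.
From mathcomp Require Import generic_quotient sesquilinear complex.
From mathcomp Require Import all_classical all_reals all_analysis.
From mathcomp Require Import measurable_realfun ess_sup_inf ring lra.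

Set Implicit Arguments.
Unset Strict Implicit.
Unset Printing Implicit Defensive.

Import Order.TTheory GRing.Theory Num.Theory.
Import numFieldNormedType.Exports Normc.

Local Open Scope classical_set_scope.
Local Open Scope complex_scope.
Local Open Scope quotient_scope.
Local Open Scope ring_scope.

(** Every power of T is again a weighted composition f |-> xi' . (f o psi')
    ([iter_wcomp]), so it suffices to show that A1 and A2 commute whenever
    each A_i is a modulus: <A_i u, v> = <T_i u, T_i v> for a weighted
    composition T_i.  Two features of such an A are visible on the integral
    of |xi'|^2 (f o psi') conj(g o psi') that defines <T f, T g>:

    - a bounded multiplier moves from one argument to the other as its
      conjugate, so A commutes with multiplications ([modulus_mul]);
    - conjugating f and g swaps the two arguments, so A commutes with complex
      conjugation and maps real functions to real functions ([modulus_real]).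

    Given f and g, put e = |f| + |g|, f = p e and g = q e with |p|, |q| <= 1.
    Then A_i f = p (A_i e) and A_i g = q (A_i e), and

      <A1 A2 f, g> = <A2 f, A1 g> = int p conj(q) (A2 e) (A1 e),

    because A1 e and A2 e are real.  The last integral is symmetric in the
    indices, hence A1 A2 = A2 A1 ([modulus_commute]).  As e is chosen
    after f and g, both factorizations are exact.

    The remaining point is that T has an adjoint.  As T is multiplication by
    xi after composition with psi, and the adjoint of a multiplication is
    multiplication by the conjugate, this concerns the composition operator C
    only.  An adjoint is unique, hence linear, so it is enough to find for
    each v some w with <C u, v> = <u, w> for all u, and by linearity u and v
    may be taken nonnegative.  For an integrable G >= 0 the image under psi
    of the measure G mu is absolutely continuous, and its Radon-Nikodym
    density k satisfies int (f o psi) G = int f k ([transfer_integrable]).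
    Sigma-finiteness extends this to square-integrable G by cutting G into
    integrable pieces ([transfer_exists]), and boundedness of C makes k
    square-integrable ([transfer_square_integrable]). *)

(** * Square-integrable functions *)

Section square_integrable.
Context {d : measure_display} {X : measurableType d} {R : realType}.
Variable mu : {measure set X -> \bar R}.
Implicit Types (f g phi : X -> R[i]).

Definition sqnorm f : \bar R := (\int[mu]_x ((normc (f x)) ^+ 2)%:E)%E.

Lemma sqnorm_ge0 f : (0 <= sqnorm f)%E.
Proof. by apply: integral_ge0 => x _; rewrite lee_fin sqr_ge0. Qed.

Lemma measurable_sqnormc f : cmeasurable f ->
  measurable_fun setT (fun x => ((normc (f x)) ^+ 2)%:E).
Proof.
move=> mf; apply/measurable_EFinP; apply: (measurable_funX 2).
exact: measurable_normc.
Qed.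

Lemma cLfun2P f : f \in cLfun mu 2 <-> cmeasurable f /\ (sqnorm f < +oo)%E.
Proof.
rewrite cLfunP; split=> -[mf ff]; split => //.
  have Lf : (@normc R \o f) \in Lfun mu 2%:E.
    rewrite inE; apply/andP; split; rewrite inE//; exact: measurable_normc.
  have /integrableP[_] := Lfun2_integrable_sqr Lf; apply: le_lt_trans.
  by rewrite le_eqVlt; apply/orP; left; apply/eqP; apply: eq_integral => x _ /=;
    rewrite ger0_norm ?sqr_ge0.
rewrite /finite_norm unlock poweR_lty//; apply: le_lt_trans ff.
rewrite le_eqVlt; apply/orP; left; apply/eqP; apply: eq_integral => x _ /=.
by rewrite ger0_norm ?normc_ge0// powR_mulrn ?normc_ge0.
Qed.

Lemma sqnorm_bound_mul (M : R) phi f : cmeasurable phi -> cmeasurable f ->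
  (\forall x \ae mu, normc (phi x) <= M) ->
  (sqnorm (fun x => phi x * f x)%R <= (M ^+ 2)%:E * sqnorm f)%E.
Proof.
move=> mphi mf phiM; rewrite /sqnorm -ge0_integralZl//; last 3 first.
- exact: measurable_sqnormc.
- by move=> x _; rewrite lee_fin sqr_ge0.
- by rewrite lee_fin sqr_ge0.
apply: ae_ge0_le_integral => //.
- by move=> x _; rewrite lee_fin sqr_ge0.
- by apply: measurable_sqnormc; exact: cmeasurableM.
- by move=> x _; rewrite -EFinM lee_fin mulr_ge0// sqr_ge0.
- by apply: measurable_funeM; exact: measurable_sqnormc.
- apply: filterS phiM => x phiM _; rewrite -EFinM lee_fin normcM exprMn.
  rewrite ler_wpM2r ?sqr_ge0// lerXn2r// ?nnegrE ?normc_ge0//.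
  exact: le_trans (normc_ge0 _) phiM.
Qed.

(** The norm of order +oo is 0 by convention when mu is the null measure; then
    every bound holds almost everywhere. *)
Lemma cLfun_infty_bounded phi : phi \in cLfun mu +oo%E ->
  cmeasurable phi /\ exists M : R, \forall x \ae mu, normc (phi x) <= M.
Proof.
move=> /cLfunP[mphi]; rewrite /finite_norm unlock; case: ifPn => [mu0|].
  move=> h; split => //.
  have [|M hM] := @ess_supr_bounded _ _ _ mu (Num.norm \o (@normc R \o phi)).
    exact: h.
  exists M; apply: filterS hM => x; apply: le_trans => /=.
  exact: ler_norm.
rewrite -leNgt => mu0 _; split => //; exists 0.
exists setT; split => //.
by apply/eqP; rewrite eq_le mu0 measure_ge0.
Qed.

Lemma cLfun_mul (M : R) phi f : cmeasurable phi ->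
  (\forall x \ae mu, normc (phi x) <= M) -> f \in cLfun mu 2 ->
  (fun x => phi x * f x) \in cLfun mu 2.
Proof.
move=> mphi phiM /cLfun2P[mf ff]; apply/cLfun2P; split; first exact: cmeasurableM.
apply: le_lt_trans (sqnorm_bound_mul mphi mf phiM) _.
by rewrite lte_mul_pinfty// lee_fin sqr_ge0.
Qed.

Lemma cLfun2_conj f : f \in cLfun mu 2 -> (fun x => (f x)^*%C) \in cLfun mu 2.
Proof.
move=> /cLfun2P[mf ff]; apply/cLfun2P; split; first exact: cmeasurable_conj.
rewrite (_ : sqnorm _ = sqnorm f)//; apply: eq_integral => x _.
by rewrite !normcE2; case: (f x) => a b /=; rewrite sqrrN.
Qed.

Lemma dotL2_self (f : L2fun mu) :
  dotL2 mu (\pi_(L2 mu) f) (\pi_(L2 mu) f) = (fine (sqnorm f))%:C.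
Proof.
rewrite dotL2E /cintegral; congr (_ +i* _).
  apply: eq_Rintegral => x _; rewrite normcE2.
  rewrite sqr_sqrtr ?addr_ge0 ?sqr_ge0//.
  by case: (f x) => a b /=; rewrite mulrN opprK !expr2.
rewrite (_ : \int[mu]_x _ = \int[mu]_x 0); first by rewrite Rintegral_cst// mul0r.
apply: eq_Rintegral => x _.
by case: (f x) => a b /=; rewrite mulrN mulrC addNr.
Qed.

Lemma sqnorm_fin (f : L2fun mu) : sqnorm f \is a fin_num.
Proof. by rewrite ge0_fin_numE ?sqnorm_ge0//; case/cLfun2P: (L2funP f). Qed.

(** Elements of L2 are compared through their inner products throughout:
    values of operators are only known in this weak sense. *)
Lemma dotL2_inj (u v : L2 mu) :
  (forall w, dotL2 mu u w = dotL2 mu v w) -> u = v.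
Proof.
move=> uv; apply/eqP; rewrite -subr_eq0; apply: contraT => /dotL2_gt0.
by rewrite linearBl /= uv subrr ltxx.
Qed.

End square_integrable.

(** * Transfer of functions along a composition *)

(** The measure G mu; the two hypotheses are parameters because the measure
    structure declared below has to be found from the term itself. *)
Definition mdensity {d} {X : measurableType d} {R : realType}
    (mu : {measure set X -> \bar R}) (G : X -> \bar R)
    of (forall x, 0 <= G x)%E & mu.-integrable setT G :=
  fun A => (\int[mu]_(x in A) G x)%E.

Section density.
Local Open Scope ereal_scope.
Context {d : measure_display} {X : measurableType d} {R : realType}.
Variable mu : {measure set X -> \bar R}.
Variables (G : X -> \bar R) (G0 : forall x, 0 <= G x) (iG : mu.-integrable setT G).

Local Notation nu := (mdensity G0 iG).

Let nu0 : nu set0 = 0. Proof. by rewrite /mdensity integral_set0. Qed.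
Let nu_ge0 A : 0 <= nu A. Proof. exact: integral_ge0. Qed.
Let nu_sigma : semi_sigma_additive nu.
Proof. by apply: semi_sigma_additive_nng_induced => //; exact: measurable_int iG. Qed.

HB.instance Definition _ := isMeasure.Build _ _ _ nu nu0 nu_ge0 nu_sigma.

Let nu_fin : fin_num_fun nu.
Proof.
by move=> A mA; apply: integrable_fin_num => //; exact: integrableS iG.
Qed.

HB.instance Definition _ := @Measure_isFinite.Build _ _ _ nu nu_fin.

Lemma mdensity_dominates : nu `<< mu.
Proof.
apply/null_content_dominatesP => A mA muA0; apply: null_set_integral => //.
by apply: measurable_funTS; exact: measurable_int iG.
Qed.
End density.

Section density_integral.
Local Open Scope ereal_scope.
Context {d : measure_display} {X : measurableType d} {R : realType}.
Variable mu : {sigma_finite_measure set X -> \bar R}.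
Variables (G : X -> \bar R) (G0 : forall x, 0 <= G x) (iG : mu.-integrable setT G).

(** G is almost everywhere the Radon-Nikodym derivative of G mu, since both
    have the same integrals over measurable sets; the change of variables known
    for that derivative then holds for G. *)
Lemma integral_mdensity (f : X -> \bar R) : measurable_fun setT f ->
  (forall x, 0 <= f x) ->
  \int[mdensity G0 iG]_x f x = \int[mu]_x (f x * G x).
Proof.
move=> mf f0.
have dom := mdensity_dominates G0 iG.
rewrite -(Radon_Nikodym_SigmaFinite.change_of_variables dom)//.
have iF := Radon_Nikodym_SigmaFinite.f_integrable dom.
apply: ge0_ae_eq_integral => //.
- by apply: emeasurable_funM => //; exact: measurable_int iF.
- by apply: emeasurable_funM => //; exact: measurable_int iG.
- by move=> x _; rewrite mule_ge0// Radon_Nikodym_SigmaFinite.f_ge0.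
- by move=> x _; rewrite mule_ge0.
- apply: ae_eqe_mul2l; apply: integral_ae_eq => //; first exact: measurable_int iG.
  by move=> A _ mA; rewrite -Radon_Nikodym_SigmaFinite.f_integral.
Qed.
End density_integral.

(** Boundedness of f |-> f o psi, read on nonnegative real functions and with
    the squared norm. *)
Definition bounded_comp {d} {X : measurableType d} {R : realType}
    (mu : {measure set X -> \bar R}) (psi : X -> X) :=
  exists2 C : R, (0 < C)%R &
  forall f : X -> R, measurable_fun setT f -> (forall x, 0 <= f x)%R ->
  (\int[mu]_x ((f x) ^+ 2)%:E < +oo)%E ->
  (\int[mu]_x ((f (psi x)) ^+ 2)%:E <= C%:E * \int[mu]_x ((f x) ^+ 2)%:E)%E.

Section transfer.
Local Open Scope ereal_scope.
Context {d : measure_display} {X : measurableType d} {R : realType}.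
Variable mu : {sigma_finite_measure set X -> \bar R}.
Variable psi : X -> X.
Hypothesis mpsi : measurable_fun setT psi.
Hypothesis bpsi : bounded_comp mu psi.

(** On an indicator function the bound reads mu (psi^-1 A) <= C mu A. *)
Lemma bounded_comp_nonsingular A :
  measurable A -> mu A = 0 -> mu (psi @^-1` A) = 0.
Proof.
move=> mA muA0; have [C C0 hC] := bpsi.
have mpA : measurable (psi @^-1` A).
  by rewrite -[X in measurable X]setTI; exact: mpsi.
have sq B : measurable B -> \int[mu]_x ((\1_B x : R) ^+ 2)%:E = mu B.
  move=> mB; rewrite -[in RHS](setIT B) -integral_indic//.
  by apply: eq_integral => x _; rewrite indicE; case: (x \in B); rewrite ?expr1n ?expr0n.
have := hC (\1_A) (measurable_indic mA) (fun x => ler0n _ (x \in A)).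
rewrite sq// muA0 mule0 (sq _ mpA) => /(_ (ltry _)) le0.
by apply/eqP; rewrite eq_le le0 measure_ge0.
Qed.

(** k is what the adjoint of the composition operator, that is the transfer
    (Perron-Frobenius) operator of psi, makes of G. *)
Definition transfer_of (G k : X -> \bar R) :=
  [/\ measurable_fun setT k, (forall x, 0 <= k x) &
    forall f : X -> R, measurable_fun setT f -> (forall x, 0 <= f x)%R ->
      \int[mu]_x ((f (psi x))%:E * G x) = \int[mu]_x ((f x)%:E * k x)].

(** k is the density with respect to mu of the image under psi of G mu; that
    image is finite because G is integrable, and absolutely continuous because
    psi pulls null sets back to null sets. *)
Lemma transfer_integrable (G : X -> \bar R) : (forall x, 0 <= G x) ->
  mu.-integrable setT G -> exists k, transfer_of G k.
Proof.
move=> G0 iG.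
pose nu' : {measure set X -> \bar R} := pushforward (mdensity G0 iG) psi.
pose nu := nu' mpsi.
have nufin : fin_num_fun nu.
  move=> A mA.
  apply: (fin_num_measure (mdensity G0 iG : {finite_measure set X -> \bar R})).
  by rewrite -[X in measurable X]setTI; exact: mpsi.
pose fnu : {finite_measure set X -> \bar R} :=
  HB.pack (nu : set X -> \bar R) (Measure.class nu) (Measure_isFinite.Build _ _ _ nu nufin).
have dom : fnu `<< mu.
  apply/null_content_dominatesP => A mA muA0.
  have mpA : measurable (psi @^-1` A).
    by rewrite -[X in measurable X]setTI; exact: mpsi.
  by move/null_content_dominatesP : (mdensity_dominates G0 iG); apply => //;
    exact: bounded_comp_nonsingular.
exists (Radon_Nikodym_SigmaFinite.f fnu mu); split.
- exact: measurable_int (Radon_Nikodym_SigmaFinite.f_integrable dom).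
- exact: Radon_Nikodym_SigmaFinite.f_ge0.
move=> f mf f0.
have mEf : measurable_fun setT (EFin \o f) by exact/measurable_EFinP.
have Ef0 x : 0 <= (EFin \o f) x by rewrite lee_fin.
rewrite (Radon_Nikodym_SigmaFinite.change_of_variables dom Ef0)//.
transitivity (\int[mdensity G0 iG]_x ((EFin \o f) \o psi) x).
  rewrite integral_mdensity//; last by move=> x; exact: Ef0.
  exact: measurableT_comp.
by rewrite -[RHS]/(\int[pushforward (mdensity G0 iG) psi]_x (EFin \o f) x)
  ge0_integral_pushforward.
Qed.

(** As G <= G^2 + 1, G is integrable on sets of finite measure and hence a
    countable sum of integrable pieces; their transfers add up, as all terms are
    nonnegative. *)
Lemma transfer_exists (G : X -> R) : measurable_fun setT G ->
  (forall x, 0 <= G x)%R -> \int[mu]_x ((G x) ^+ 2)%:E < +oo ->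
  exists k, transfer_of (EFin \o G) k.
Proof.
move=> mG G0 G2.
have [F FX mF] := sigma_finiteT mu.
pose D := seqDU F.
have mD n : measurable (D n).
  by apply: seqDU_measurable => i; exact: (mF i).1.
have muD n : mu (D n) < +oo.
  apply: le_lt_trans (mF n).2; apply: le_measure; rewrite ?inE//.
    exact: (mF n).1.
  exact: subDsetl.
have tD : trivIset setT D by exact: trivIset_seqDU.
have DX : \bigcup_n D n = setT by rewrite /D -seqDU_bigcup_eq -FX.
pose Gn n x := (G x * \1_(D n) x)%:E.
have Gn0 n x : 0 <= Gn n x by rewrite lee_fin mulr_ge0.
have mGn n : measurable_fun setT (Gn n).
  by apply/measurable_EFinP; apply: measurable_funM => //; exact: measurable_indic.
have mG2 : measurable_fun setT (fun x => ((G x) ^+ 2)%:E).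
  by apply/measurable_EFinP; exact: measurable_funX.
have m1D n : measurable_fun setT (fun x => (\1_(D n) x : R)%:E).
  by apply/measurable_EFinP; exact: measurable_indic.
have iGn n : mu.-integrable setT (Gn n).
  apply/integrableP; split => //.
  apply: (@le_lt_trans _ _
    (\int[mu]_x (((G x) ^+ 2)%:E + (\1_(D n) x)%:E))).
    apply: ge0_le_integral => //; first exact: measurableT_comp.
      by apply: emeasurable_funD.
    move=> x _; rewrite gee0_abs// -EFinD lee_fin.
    have := G0 x; rewrite indicE; case: (x \in D n) => /=; last by nra.
    by move=> Gx; rewrite mulr1; nra.
  rewrite ge0_integralD//; last by move=> x _; rewrite lee_fin sqr_ge0.
  by rewrite lte_add_pinfty// integral_indic// setIT; exact: muD.
have /choice[k hk] : forall n, exists k, transfer_of (Gn n) k.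
  by move=> n; exact: transfer_integrable (Gn0 n) (iGn n).
have mk n : measurable_fun setT (k n) by case: (hk n).
have k0 n x : 0 <= k n x by case: (hk n).
exists (fun x => \sum_(n <oo) k n x); split.
- rewrite (_ : (fun _ => _) = (fun x => \sum_(0 <= i <oo | i \in xpredT) k i x))//.
  by apply: ge0_emeasurable_sum.
- by move=> x; exact: nneseries_ge0.
move=> f mf f0.
have mEf : measurable_fun setT (fun x => (f x)%:E) by exact/measurable_EFinP.
transitivity (\int[mu]_x (\sum_(n <oo) ((f x)%:E * k n x))); last first.
  by apply: eq_integral => x _; rewrite nneseriesZl.
rewrite integral_nneseries//; last 2 first.
- by move=> n; exact: emeasurable_funM.
- by move=> n x _; rewrite mule_ge0// lee_fin.
have mfG : measurable_fun setT (fun x => (f (psi x))%:E * (G x)%:E).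
  apply: emeasurable_funM; last exact/measurable_EFinP.
  by apply/measurable_EFinP; exact: measurableT_comp.
transitivity (\int[mu]_(x in \bigcup_n D n) ((f (psi x))%:E * (G x)%:E)).
  by rewrite DX.
rewrite ge0_integral_bigcup//; last 2 first.
- by apply: measurable_funTS.
- by move=> x _; rewrite mule_ge0// lee_fin.
apply: eq_eseriesr => n _.
have [_ _ <-//] := hk n.
rewrite integral_mkcond; apply: eq_integral => x _.
rewrite patchE /Gn indicE; case: ifPn => xD; rewrite ?mulr1 ?mulr0//.
by rewrite mule0.
Qed.

(** A square-integrable truncation f <= k satisfies, by the inequality between
    the arithmetic and geometric means with weight C and by the bound on the
    composition,
      int f^2 <= int f k = int (f o psi) G
              <= (1 / 2C) int (f o psi)^2 + (C / 2) int G^2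
              <= (1 / 2) int f^2 + (C / 2) int G^2.
    Since int f^2 is finite, int f^2 <= C int G^2, and this bound passes to the
    limit along truncations that increase to k. *)
Lemma transfer_square_integrable (G : X -> R) (k : X -> \bar R) : measurable_fun setT G ->
  (forall x, 0 <= G x)%R -> \int[mu]_x ((G x) ^+ 2)%:E < +oo ->
  transfer_of (EFin \o G) k ->
  \int[mu]_x (k x * k x) < +oo.
Proof.
move=> mG G0 G2 [mk k0 kE].
have [C C0 hC] := bpsi.
have [F [FX ndF mF]] := (sigma_finiteP _ _).1 (sigma_finiteT mu).
(* Cutting both the values and the domain makes the truncation
   square-integrable. *)
pose f n x := (fine (mine (k x) n%:R%:E) * \1_(F n) x)%R.
have finm n x : mine (k x) n%:R%:E \is a fin_num.
  rewrite ge0_fin_numE; first by rewrite gt_min ltry orbT.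
  by rewrite le_min k0 lee_fin ler0n.
have f0 n x : (0 <= f n x)%R.
  rewrite mulr_ge0// fine_ge0// le_min k0 lee_fin; exact: ler0n.
have mf n : measurable_fun setT (f n).
  apply: measurable_funM; last by apply: measurable_indic; exact: (mF n).1.
  apply: measurableT_comp; first exact: fine_measurable.
  by apply: measurable_mine => //.
have mEf n : measurable_fun setT (fun x => (f n x)%:E).
  by have /measurable_EFinP := mf n.
have mf2 n : measurable_fun setT (fun x => ((f n x) ^+ 2)%:E).
  by apply/measurable_EFinP; exact: measurable_funX.
have mG2 : measurable_fun setT (fun x => ((G x) ^+ 2)%:E).
  by apply/measurable_EFinP; exact: measurable_funX.
have ffin n : \int[mu]_x ((f n x) ^+ 2)%:E < +oo.
  apply: (@le_lt_trans _ _ (\int[mu]_x ((n%:R ^+ 2)%:E * (\1_(F n) x)%:E))).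
    apply: ge0_le_integral => //.
    - by move=> x _; rewrite lee_fin sqr_ge0.
    - apply: measurable_funeM; apply/measurable_EFinP; apply: measurable_indic.
      exact: (mF n).1.
    - move=> x _; rewrite -EFinM lee_fin /f exprMn.
      rewrite indicE; case: (x \in F n) => /=; rewrite ?expr0n ?mulr0// !expr1n !mulr1.
      rewrite lerXn2r ?nnegrE ?fine_ge0//; first by rewrite le_min k0 lee_fin ler0n.
      by rewrite -lee_fin fineK// ge_min lexx orbT.
  rewrite ge0_integralZl//; last first.
    by apply/measurable_EFinP; apply: measurable_indic; exact: (mF n).1.
  rewrite integral_indic//; last exact: (mF n).1.
  by rewrite setIT lte_mul_pinfty// ?lee_fin ?sqr_ge0//; exact: (mF n).2.
set b := \int[mu]_x ((G x) ^+ 2)%:E in G2.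
have b0 : 0 <= b by apply: integral_ge0 => x _; rewrite lee_fin sqr_ge0.
have fb n : \int[mu]_x ((f n x) ^+ 2)%:E <= C%:E * b.
  set a := \int[mu]_x ((f n x) ^+ 2)%:E.
  have a0 : 0 <= a by apply: integral_ge0 => x _; rewrite lee_fin sqr_ge0.
  have afin : a \is a fin_num by rewrite ge0_fin_numE// ffin.
  have bfin : b \is a fin_num by rewrite ge0_fin_numE.
  pose c := \int[mu]_x ((f n (psi x)) ^+ 2)%:E.
  have ca : c <= C%:E * a by exact: hC.
  have mfp2 : measurable_fun setT (fun x => ((f n (psi x)) ^+ 2)%:E).
    apply/measurable_EFinP; apply: measurable_funX.
    exact: (measurableT_comp (mf n)).
  have c0 : 0 <= c by apply: integral_ge0 => x _; rewrite lee_fin sqr_ge0.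
  have cfin : c \is a fin_num.
    rewrite ge0_fin_numE//; apply: le_lt_trans ca _.
    by rewrite lte_mul_pinfty// ?lee_fin ?ltW// ltey_eq afin.
  have : a <= (2 * C)^-1%:E * c + (C / 2)%:E * b.
    apply: (@le_trans _ _ (\int[mu]_x ((f n x)%:E * k x))).
      apply: ge0_le_integral => //.
      - by move=> x _; rewrite lee_fin sqr_ge0.
      - exact: emeasurable_funM.
      - move=> x _; rewrite expr2 EFinM lee_wpmul2l ?lee_fin//.
        rewrite /f indicE; case: (x \in F n); rewrite ?mulr1 ?mulr0//.
        by rewrite fineK// ge_min lexx.
    rewrite -kE// -!ge0_integralZl//; last 4 first.
    - by move=> x _; rewrite lee_fin sqr_ge0.
    - by rewrite lee_fin divr_ge0// ltW.
    - by move=> x _; rewrite lee_fin sqr_ge0.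
    - by rewrite lee_fin invr_ge0 mulr_ge0// ltW.
    rewrite -ge0_integralD//; last 4 first.
    - move=> x _; rewrite -EFinM lee_fin mulr_ge0 ?sqr_ge0//.
      by rewrite invr_ge0 mulr_ge0// ltW.
    - exact: measurable_funeM.
    - by move=> x _; rewrite -EFinM lee_fin mulr_ge0 ?sqr_ge0// divr_ge0// ltW.
    - exact: measurable_funeM.
    apply: ge0_le_integral => //.
    - by move=> x _; rewrite mule_ge0// lee_fin.
    - apply: emeasurable_funM; apply/measurable_EFinP => //.
      exact: (measurableT_comp (mf n)).
    - by apply: emeasurable_funD; exact: measurable_funeM.
    - move=> x _; rewrite -!EFinM -EFinD lee_fin.
      rewrite -subr_ge0.
      rewrite (_ : _ - _ = (2 * C)^-1 * (f n (psi x) - C * G x) ^+ 2)%R.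
        by rewrite mulr_ge0 ?sqr_ge0// invr_ge0 mulr_ge0// ltW.
      by field; rewrite gt_eqF.
  move: ca; rewrite -(fineK afin) -(fineK bfin) -(fineK cfin).
  rewrite -!EFinM -EFinD !lee_fin => ca.
  have : ((2 * C)^-1 * fine c <= fine a / 2)%R.
    rewrite invfM -mulrA mulrC ler_pM2r// mulrC ler_pdivrMr// mulrC; exact: ca.
  lra.
pose g n x := ((f n x) ^+ 2)%:E.
have gk x : limn (g ^~ x) = k x * k x.
  apply/cvg_lim => //.
  have [N _ xF] : exists2 N : nat, True & F N x.
    by have : setT x by []; rewrite FX => -[N _ FN]; exists N.
  have xFn n : (N <= n)%N -> x \in F n.
    by move=> Nn; rewrite inE; move/subsetPset: (ndF _ _ Nn); apply.
  have [kx|kfin] := eqVneq (k x) +oo.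
    rewrite kx mulyy; apply/cvgeyPge => A.
    near=> n; rewrite /g lee_fin /f indicE xFn; last by near: n; exists N.
    rewrite kx minye/= mulr1.
    have n1 : (1 <= n)%N by near: n; exists 1%N.
    have An : (A <= n%:R)%R by near: n; exact: nbhs_infty_ger.
    apply: le_trans An _; rewrite expr2 ler_peMl ?ler0n// ler1n//.
  have {}kfin : k x \is a fin_num by rewrite ge0_fin_numE// lt_neqAle kfin leey.
  apply: cvg_near_cst; near=> n.
  rewrite /g /f indicE xFn; last by near: n; exists N.
  have kn : (fine (k x) <= n%:R)%R by near: n; exact: nbhs_infty_ger.
  rewrite min_l; last by rewrite -(fineK kfin) lee_fin.
  by rewrite mulr1 expr2 EFinM fineK.
rewrite (eq_integral (fun x => limn (g ^~ x))); last by move=> x _; rewrite gk.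
have gnd x : {homo g^~ x : n m / (n <= m)%N >-> n <= m}.
  move=> n m nm; rewrite lee_fin lerXn2r ?nnegrE// /f.
  have Fnm : F n `<=` F m by apply/subsetPset; exact: ndF.
  rewrite !indicE; case: (boolP (x \in F n)) => xn; last first.
    rewrite mulr0 mulr_ge0// fine_ge0// le_min k0 lee_fin; exact: ler0n.
  rewrite (_ : x \in F m); last by rewrite inE; apply: Fnm; rewrite inE in xn.
  rewrite !mulr1 fine_le//.
  by rewrite le_min ge_min lexx/= ge_min lee_fin ler_nat nm orbT.
rewrite monotone_convergence//; last first.
  by move=> n x _; rewrite lee_fin sqr_ge0.
apply: (@le_lt_trans _ _ (C%:E * b)); last first.
  by rewrite lte_mul_pinfty// lee_fin ltW.
apply: lime_le; last by apply: nearW => n; exact: fb.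
apply: ereal_nondecreasing_is_cvgn => n m nm.
apply: ge0_le_integral => //.
- by move=> x _; rewrite lee_fin sqr_ge0.
- exact: mf2.
- exact: mf2.
- by move=> x _; exact: gnd.
Unshelve. all: by end_near. Qed.

(** k^2 is integrable, so k is finite almost everywhere and may be replaced by
    a real-valued function. *)
Lemma transfer_real_valued (G : X -> R) : measurable_fun setT G ->
  (forall x, 0 <= G x)%R -> \int[mu]_x ((G x) ^+ 2)%:E < +oo ->
  exists k : X -> R, [/\ measurable_fun setT k, (forall x, 0 <= k x)%R,
    \int[mu]_x ((k x) ^+ 2)%:E < +oo &
    forall f : X -> R, measurable_fun setT f -> (forall x, 0 <= f x)%R ->
      \int[mu]_x (f (psi x) * G x)%:E = \int[mu]_x (f x * k x)%:E].
Proof.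
move=> mG G0 G2.
have [k hk] := transfer_exists mG G0 G2.
have kk := transfer_square_integrable mG G0 G2 hk.
have [mk k0 kE] := hk.
have mkk : measurable_fun setT (fun x => k x * k x) by exact: emeasurable_funM.
have kfin : \forall x \ae mu, k x \is a fin_num.
  have ikk : mu.-integrable setT (fun x => k x * k x).
    apply/integrableP; split => //.
    rewrite (eq_integral (fun x => k x * k x))// => x _.
    by rewrite gee0_abs// mule_ge0.
  apply: filterS (integrable_ae measurableT ikk) => x /(_ Logic.I) kkx.
  by rewrite ge0_fin_numE// ltey; apply: contraTneq kkx => ->; rewrite mulyy.
have mfk : measurable_fun setT (fine \o k).
  by apply: measurableT_comp => //; exact: fine_measurable.
exists (fine \o k); split => //.
- by move=> x; exact: fine_ge0.
- rewrite (ge0_ae_eq_integral _ _ mkk)//.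
  + by apply/measurable_EFinP; exact: measurable_funX.
  + by move=> x _; rewrite lee_fin sqr_ge0.
  + by move=> x _; rewrite mule_ge0.
  + by apply: filterS kfin => x kx _; rewrite /= expr2 EFinM fineK.
move=> f mf f0.
have mEf : measurable_fun setT (fun x => (f x)%:E) by exact/measurable_EFinP.
transitivity (\int[mu]_x ((f x)%:E * k x)).
  by rewrite -kE//; apply: eq_integral => x _; rewrite EFinM.
apply: ge0_ae_eq_integral => //.
- exact: emeasurable_funM.
- by apply/measurable_EFinP; exact: measurable_funM.
- by move=> x _; rewrite mule_ge0// lee_fin.
- by move=> x _; rewrite lee_fin mulr_ge0// fine_ge0.
- by apply: filterS kfin => x kx _; rewrite EFinM fineK.
Qed.

End transfer.

(** * The inner product on classes *)

Section real_part.
Context {d : measure_display} {X : measurableType d} {R : realType}.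
Variable mu : {measure set X -> \bar R}.

Lemma sqnorm_real (h : X -> R) :
  sqnorm mu (fun x => (h x)%:C) = (\int[mu]_x ((h x) ^+ 2)%:E)%E.
Proof.
apply: eq_integral => x _; rewrite normcE2/= expr0n addr0.
by rewrite sqr_sqrtr ?sqr_ge0.
Qed.

Lemma cLfun2_real (h : X -> R) : (fun x => (h x)%:C) \in cLfun mu 2 <->
  measurable_fun setT h /\ (\int[mu]_x ((h x) ^+ 2)%:E < +oo)%E.
Proof.
rewrite cLfun2P sqnorm_real; split=> -[mh ?]; split => //; first by case: mh.
by split => //; exact: measurable_cst.
Qed.

Lemma cLfun2_dominated (f g : X -> R[i]) : cmeasurable g ->
  (forall x, normc (g x) <= normc (f x)) -> f \in cLfun mu 2 ->
  g \in cLfun mu 2.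
Proof.
move=> mg gf /cLfun2P[mf ff]; apply/cLfun2P; split => //.
apply: le_lt_trans ff; apply: ge0_le_integral => //.
- by move=> x _; rewrite lee_fin sqr_ge0.
- exact: measurable_sqnormc.
- exact: measurable_sqnormc.
- by move=> x _; rewrite lee_fin lerXn2r ?nnegrE ?normc_ge0.
Qed.

(** A complex function is a combination of the positive and negative parts of
    its real and imaginary parts, so a property stable under linear combinations
    need only be checked on nonnegative functions. *)
Lemma L2_nonneg_ind (P : L2 mu -> Prop) :
  (forall (a : R[i]) u v, P u -> P v -> P (a *: u + v)) ->
  (forall (h : L2fun mu) (r : X -> R), (forall x, 0 <= r x) ->
    (forall x, h x = (r x)%:C) -> P (\pi_(L2 mu) h)) ->
  forall u, P u.
Proof.
move=> Plin Ppos u; rewrite -[u]reprK; move: (repr u) => f {u}.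
have [[mRe mIm] _] := (cLfun2P mu f).1 (L2funP f).
have Lr (r : X -> R) : measurable_fun setT r -> (forall x, `|r x| <= normc (f x)) ->
    (fun x => (r x)%:C) \in cLfun mu 2.
  move=> mr rf; apply: cLfun2_dominated (L2funP f).
    by split => //; exact: measurable_cst.
  by move=> x; rewrite normcE2/= expr0n addr0 sqrtr_sqr.
have Ref x : `|complex.Re (f x)| <= normc (f x).
  by rewrite normcE2 -sqrtr_sqr ler_wsqrtr// lerDl sqr_ge0.
have Imf x : `|complex.Im (f x)| <= normc (f x).
  by rewrite normcE2 -sqrtr_sqr ler_wsqrtr// lerDr sqr_ge0.
have pos (r : X -> R) : measurable_fun setT r -> (forall x, `|r x| <= normc (f x)) ->
    exists p n : L2fun mu, [/\ P (\pi_(L2 mu) p), P (\pi_(L2 mu) n) &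
      forall x, p x - n x = (r x)%:C].
  move=> mr rf.
  pose p x := Num.max (r x) 0; pose n x := Num.max (- r x) 0.
  have Lp : (fun x => (p x)%:C) \in cLfun mu 2.
    apply: Lr; first by apply: measurable_maxr.
    move=> x; apply: le_trans (rf x); rewrite /p.
    by case: (lerP 0 (r x)) => ?; rewrite ?normr0// ger0_norm.
  have Ln : (fun x => (n x)%:C) \in cLfun mu 2.
    apply: Lr; first by apply: measurable_maxr => //; exact: measurable_funN.
    move=> x; apply: le_trans (rf x); rewrite /n.
    by case: (lerP 0 (- r x)) => ?; rewrite ?normr0// normrN.
  exists (MkL2fun Lp), (MkL2fun Ln); split.
  - by apply: (Ppos _ p) => // x; rewrite le_max lexx orbT.
  - by apply: (Ppos _ n) => // x; rewrite le_max lexx orbT.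
  - move=> x; rewrite /= -rmorphB/=; congr (_%:C); rewrite /p /n.
    by case: (lerP 0 (r x)) => ?; case: (lerP 0 (- r x)) => ?; lra.
have [p1 [n1 [Pp1 Pn1 E1]]] := pos _ mRe Ref.
have [p2 [n2 [Pp2 Pn2 E2]]] := pos _ mIm Imf.
have -> : \pi_(L2 mu) f = (-1) *: \pi_(L2 mu) n1 + ((- 'i%C) *: \pi_(L2 mu) n2 +
    ('i%C *: \pi_(L2 mu) p2 + \pi_(L2 mu) p1)).
  have scE (a : R[i]) g : a *: \pi_(L2 mu) g = \pi_(L2 mu) (a *: g) by exact: scaleL2E.
  rewrite !scE !addL2E; apply/eqL2P; apply: aeW => x _.
  rewrite -[RHS]/(-1 * n1 x + (- 'i%C * n2 x + ('i%C * p2 x + p1 x))).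
  rewrite [LHS]complexE -E1 -E2; ring.
by do 3 apply: (Plin _) => //.
Qed.

Lemma dotL2_real (f g : L2fun mu) (h k : X -> R) :
  (forall x, f x = (h x)%:C) -> (forall x, g x = (k x)%:C) ->
  dotL2 mu (\pi_(L2 mu) f) (\pi_(L2 mu) g) = (\int[mu]_x (h x * k x))%:C.
Proof.
move=> fh gk; rewrite dotL2E /cintegral; congr (_ +i* _).
  by apply: eq_Rintegral => x _; rewrite fh gk /= oppr0 mulr0 subr0.
rewrite (_ : \int[mu]_x _ = \int[mu]_x 0); first by rewrite Rintegral_cst// mul0r.
by apply: eq_Rintegral => x _; rewrite fh gk /= oppr0 mulr0 mul0r addr0.
Qed.

End real_part.

Section bounded_forms.
Context {d : measure_display} {X : measurableType d} {R : realType}.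
Variable mu : {measure set X -> \bar R}.

Lemma dotL2_ge0 (u : L2 mu) : 0 <= dotL2 mu u u.
Proof.
by rewrite -[u]reprK dotL2_self lecR fine_ge0 ?sqnorm_ge0.
Qed.

(** The constant in the definition of a bounded operator is a complex number,
    without sign condition; squaring turns it into a positive real one. *)
Lemma bounded_opP (T : L2 mu -> L2 mu) : bounded_op (dotL2 mu) T <->
  exists2 K : R, 0 < K & forall u, dotL2 mu (T u) (T u) <= K%:C * dotL2 mu u u.
Proof.
split=> [[M hM]|[K K0 hK]].
  exists (normc M ^+ 2 + 1); first by rewrite ltr_wpDl ?sqr_ge0.
  move=> u; have hu := hM u.
  set a := dotL2 mu _ _ in hu *; set b := dotL2 mu u u in hu *.
  have a0 : 0 <= a by exact: dotL2_ge0.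
  have b0 : 0 <= b by exact: dotL2_ge0.
  have Mb0 : 0 <= M * sqrtC b by apply: le_trans hu; rewrite sqrtC_ge0.
  have -> : a = sqrtC a ^+ 2 by rewrite sqrtCK.
  apply: (@le_trans _ _ ((M * sqrtC b) ^+ 2)).
    by rewrite lerXn2r// nnegrE ?sqrtC_ge0.
  rewrite -(ger0_norm Mb0) normrM (ger0_norm (_ : 0 <= sqrtC b)) ?sqrtC_ge0//.
  rewrite exprMn sqrtCK ler_wpM2r//.
  rewrite rmorphD rmorphXn /= -[leLHS]addr0 lerD// lecR; exact: ler01.
exists (sqrtC K%:C) => u; have K0' : 0 <= K%:C :> R[i] by rewrite lecR ltW.
rewrite -sqrtCM ?nnegrE ?dotL2_ge0//.
by rewrite ler_sqrtC ?nnegrE ?mulr_ge0 ?dotL2_ge0//; exact: hK.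
Qed.

(** The inner product determines w from v, so any choice of w is linear in v. *)
Lemma linear_of_adjoint (T : L2 mu -> L2 mu) :
  (forall v, exists w, forall u, dotL2 mu (T u) v = dotL2 mu u w) ->
  exists S : {linear L2 mu -> L2 mu}, is_adjoint (dotL2 mu) T S.
Proof.
move=> /choice[s hs].
have slin : linear s.
  move=> a u v; apply: dotL2_inj => w.
  rewrite dotL2_conj -hs [RHS]dotL2_conj; congr (_^*)%C.
  by rewrite !linearPr/= !hs.
pose S : {linear L2 mu -> L2 mu} :=
  HB.pack s (GRing.isLinear.Build _ _ _ _ s slin).
by exists S => u v; exact: hs.
Qed.

End bounded_forms.

(** * The adjoint of a composition operator *)

Section composition_adjoint.
Context {d : measure_display} {X : measurableType d} {R : realType}.
Variable mu : {sigma_finite_measure set X -> \bar R}.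
Variable psi : X -> X.
Hypothesis mpsi : measurable_fun setT psi.
Variable C : {linear L2 mu -> L2 mu}.
Hypothesis bC : bounded_op (dotL2 mu) C.
Hypothesis iC : induces (fun f => f \o psi) C.

Lemma composition_bounded : bounded_comp mu psi.
Proof.
have [K K0 hK] := (bounded_opP C).1 bC.
exists K => // f mf f0 ff.
have Lf : (fun x => (f x)%:C) \in cLfun mu 2 by apply/cLfun2_real.
pose F := MkL2fun Lf.
have [g gE CF] := iC F.
have := hK (\pi_(L2 mu) F); rewrite CF !dotL2_self -rmorphM lecR.
rewrite -lee_fin EFinM !fineK ?sqnorm_fin//.
by rewrite gE /F /= !sqnorm_real.
Qed.

(** Both sides are linear in u and conjugate-linear in v and w, which leaves
    the case of nonnegative u and v; there w is the transfer of v. *)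
Lemma composition_adjoint v :
  exists w, forall u, dotL2 mu (C u) v = dotL2 mu u w.
Proof.
move: v; apply: L2_nonneg_ind => [a u v [u' hu] [v' hv]|h r r0 hr].
  by exists (a *: u' + v') => w; rewrite !linearPr/= hu hv.
have := L2funP h; rewrite (_ : (h : X -> R[i]) = (fun x => (r x)%:C)); last exact/funext.
move=> /cLfun2_real[mr r2].
have [k [mk k0 k2 kE]] := transfer_real_valued mpsi composition_bounded mr r0 r2.
have Lk : (fun x => (k x)%:C) \in cLfun mu 2 by apply/cLfun2_real.
exists (\pi_(L2 mu) (MkL2fun Lk)); apply: L2_nonneg_ind => [a u v hu hv|f s s0 hs].
  by rewrite linearP !linearPl/= hu hv.
have := L2funP f; rewrite (_ : (f : X -> R[i]) = (fun x => (s x)%:C)); last exact/funext.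
move=> /cLfun2_real[ms s2].
have [g gE ->] := iC f.
rewrite (@dotL2_real _ _ _ _ _ _ (s \o psi) r)//; last first.
  by move=> x; rewrite gE /= hs.
rewrite (@dotL2_real _ _ _ _ _ _ s k)//.
by congr (_%:C); rewrite /Rintegral /= kE.
Qed.

End composition_adjoint.

(** * Multiplication operators *)

Section multiplication.
Context {d : measure_display} {X : measurableType d} {R : realType}.
Variable mu : {measure set X -> \bar R}.
Variables (phi : X -> R[i]) (M : R).
Hypothesis mphi : cmeasurable phi.
Hypothesis phiM : \forall x \ae mu, normc (phi x) <= M.

Lemma multiplication_operator : exists N : {linear L2 mu -> L2 mu},
  [/\ induces (fun f x => phi x * f x) N, bounded_op (dotL2 mu) N &
    forall v, exists w, forall u, dotL2 mu (N u) v = dotL2 mu u w].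
Proof.
pose m (f : L2fun mu) : L2fun mu := MkL2fun (cLfun_mul mphi phiM (L2funP f)).
pose n (u : L2 mu) : L2 mu := \pi_(L2 mu) (m (repr u)).
have nE f : n (\pi_(L2 mu) f) = \pi_(L2 mu) (m f).
  apply/eqL2P; apply: filterS (repr_L2 f) => x /(_ Logic.I) fx _.
  by rewrite /m /= fx.
have scE (a : R[i]) g : a *: \pi_(L2 mu) g = \pi_(L2 mu) (a *: g) by exact: scaleL2E.
have nlin : linear n.
  move=> a u v; rewrite -[u]reprK -[v]reprK scE addL2E !nE scE addL2E.
  apply/eqL2P; apply: aeW => x _.
  rewrite -[LHS]/(phi x * (a * repr u x + repr v x)).
  by rewrite -[RHS]/(a * (phi x * repr u x) + phi x * repr v x); ring.
pose N : {linear L2 mu -> L2 mu} := HB.pack n (GRing.isLinear.Build _ _ _ _ n nlin).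
exists N; split.
- by move=> f; exists (m f).
- apply/bounded_opP; exists (M ^+ 2 + 1); first by rewrite ltr_wpDl ?sqr_ge0.
  move=> u; rewrite -[u]reprK [N _]nE !dotL2_self -rmorphM lecR.
  rewrite -lee_fin EFinM !fineK ?sqnorm_fin//.
  apply: le_trans (sqnorm_bound_mul mphi (L2fun_measurable (repr u)) phiM) _.
  by rewrite lee_wpmul2r ?sqnorm_ge0// lee_fin lerDl.
- move=> v.
  have mphic : cmeasurable (fun x => (phi x)^*%C) by exact: cmeasurable_conj.
  have phicM : \forall x \ae mu, normc (phi x)^*%C <= M.
    apply: filterS phiM => x; congr (_ <= _).
    by rewrite !normcE2; case: (phi x) => a b /=; rewrite sqrrN.
  exists (\pi_(L2 mu) (MkL2fun (cLfun_mul mphic phicM (L2funP (repr v))))) => u.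
  rewrite -{1}[v]reprK -[u]reprK [N _]nE !dotL2E.
  congr cintegral; apply/funext => x /=.
  by rewrite rmorphM/= conjcK; ring.
Qed.

End multiplication.

(** * Moduli of weighted compositions *)

Section modulus.
Context {d : measure_display} {X : measurableType d} {R : realType}.
Variable mu : {measure set X -> \bar R}.

Definition wcomp (xi : X -> R[i]) (psi : X -> X) (f : X -> R[i]) : X -> R[i] :=
  fun x => xi x * f (psi x).

Definition modulus_of (T A : L2 mu -> L2 mu) :=
  forall u v, dotL2 mu (A u) v = dotL2 mu (T u) (T v).

Lemma modulus_hermitian T A : modulus_of T A ->
  forall u v, dotL2 mu (A u) v = dotL2 mu u (A v).
Proof.
by move=> hA u v; rewrite hA [RHS]dotL2_conj hA -dotL2_conj.
Qed.

Section local.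
Variables (xi : X -> R[i]) (psi : X -> X) (T A : L2 mu -> L2 mu).
Hypothesis iT : induces (wcomp xi psi) T.
Hypothesis hA : modulus_of T A.

(** With phi' the conjugate of phi, <T (phi e), T g> = <T e, T (phi' g)>: both
    integrands are |xi|^2 (phi o psi) (e o psi) conj(g o psi).  Hence
    <A (phi e), g> = <A e, phi' g> = <phi (A e), g> for every g. *)
Lemma modulus_mul (phi : X -> R[i]) (e pe pa : L2fun mu) :
  cmeasurable phi -> (forall x, normc (phi x) <= 1) ->
  (forall x, pe x = phi x * e x) ->
  (forall x, pa x = phi x * repr (A (\pi_(L2 mu) e)) x) ->
  A (\pi_(L2 mu) pe) = \pi_(L2 mu) pa.
Proof.
move=> mphi phi1 peE paE; apply: dotL2_inj => w; rewrite -[w]reprK.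
have Lpg : (fun x => (phi x)^*%C * repr w x) \in cLfun mu 2.
  apply: (@cLfun_mul _ _ _ mu 1); [exact: cmeasurable_conj| |exact: L2funP].
  apply: aeW => x; apply: le_trans (phi1 x).
  by rewrite !normcE2; case: (phi x) => a b /=; rewrite sqrrN.
pose pg := MkL2fun Lpg.
transitivity (dotL2 mu (A (\pi_(L2 mu) e)) (\pi_(L2 mu) pg)).
  rewrite !hA; have [g1 E1 ->] := iT pe; have [g2 E2 ->] := iT (repr w).
  have [g3 E3 ->] := iT e; have [g4 E4 ->] := iT pg.
  rewrite !dotL2E; congr cintegral; apply/funext => x.
  rewrite E1 E2 E3 E4 /wcomp peE /pg /= !rmorphM/= conjcK; ring.
rewrite -[A _]reprK !dotL2E; congr cintegral; apply/funext => x.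
by rewrite paE /pg /= rmorphM/= conjcK; ring.
Qed.

(** With g' the conjugate of g, <T g', T e> and <T e, T g> are integrals of the
    same function when e is real.  The first is <g', A e>, the inner product of
    the conjugate of A e with g; the second is <A e, g>. *)
Lemma modulus_real (e : L2fun mu) : (forall x, (e x)^*%C = e x) ->
  \forall x \ae mu, (repr (A (\pi_(L2 mu) e)) x)^*%C = repr (A (\pi_(L2 mu) e)) x.
Proof.
move=> eR.
pose a := repr (A (\pi_(L2 mu) e)).
pose ca : L2fun mu := MkL2fun (cLfun2_conj (L2funP a)).
have : \pi_(L2 mu) ca = \pi_(L2 mu) a.
  apply: dotL2_inj => w; rewrite -[w]reprK; set g := repr w.
  pose cg : L2fun mu := MkL2fun (cLfun2_conj (L2funP g)).
  transitivity (dotL2 mu (\pi_(L2 mu) cg) (\pi_(L2 mu) a)).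
    rewrite !dotL2E; congr cintegral; apply/funext => x /=.
    by rewrite mulrC.
  rewrite /a reprK -(modulus_hermitian hA) !hA.
  have [g1 E1 ->] := iT cg; have [g2 E2 ->] := iT e; have [g3 E3 ->] := iT g.
  rewrite !dotL2E; congr cintegral; apply/funext => x.
  by rewrite E1 E2 E3 /wcomp /cg /= !rmorphM/= eR; ring.
by move=> /eqL2P; apply: filterS => x /(_ Logic.I).
Qed.

End local.

(** Both factorizations over e = |f| + |g| take place simultaneously, which
    reduces <A1 A2 f, g> to an integral that is symmetric in A1 and A2. *)
Lemma modulus_commute xi1 psi1 T1 A1 xi2 psi2 T2 A2 :
  induces (wcomp xi1 psi1) T1 -> modulus_of T1 A1 ->
  induces (wcomp xi2 psi2) T2 -> modulus_of T2 A2 ->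
  A1 \o A2 =1 A2 \o A1.
Proof.
move=> iT1 hA1 iT2 hA2 u /=; apply: dotL2_inj => v.
rewrite [LHS](modulus_hermitian hA1) [RHS](modulus_hermitian hA2).
rewrite -[u]reprK -[v]reprK; set f := repr u; set g := repr v.
have mf := L2fun_measurable f; have mg := L2fun_measurable g.
pose r x := normc (f x) + normc (g x).
have mr : measurable_fun setT r.
  by apply: measurable_funD; exact: measurable_normc.
have r0 x : 0 <= r x by rewrite addr_ge0 ?normc_ge0.
have Lr : (fun x => (r x)%:C) \in cLfun mu 2.
  have absL (h : L2fun mu) : (fun x => (normc (h x))%:C) \in cLfun mu 2.
    apply: cLfun2_dominated (L2funP h).
      split; last exact: measurable_cst.
      by apply: measurable_normc; exact: L2fun_measurable.
    by move=> x; rewrite [leLHS]normcE2/= expr0n addr0 sqrtr_sqr ger0_norm ?normc_ge0.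
  rewrite (_ : (fun _ => _) = (MkL2fun (absL f) + MkL2fun (absL g) : L2fun mu))//.
    exact: L2funP.
  apply/funext => x; rewrite -[RHS]/((normc (f x))%:C + (normc (g x))%:C).
  by rewrite -rmorphD.
pose e := MkL2fun Lr.
have quo (h : L2fun mu) : (forall x, normc (h x) <= r x) ->
  let phi x := h x * ((r x)^-1)%:C in
  [/\ cmeasurable phi, forall x, normc (phi x) <= 1 & forall x, h x = phi x * e x].
  move=> hr phi; split.
  - apply: cmeasurableM; first exact: L2fun_measurable.
    split; last exact: measurable_cst.
    (* The inverse, which is 0 at 0, is the power of exponent -1 on nonnegative
       reals; powers are measurable. *)
    rewrite (_ : _ \o _ = (fun y : R => y `^ (-1)) \o r).
      by apply: measurableT_comp => //; exact: measurable_powR.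
    by apply/funext => x /=; rewrite powR_inv1.
  - move=> x; rewrite /phi normcM [normc _%:C]normcE2/= expr0n addr0 sqrtr_sqr.
    rewrite ger0_norm ?invr_ge0//; have [->|rx0] := eqVneq (r x) 0.
      by rewrite invr0 mulr0.
    by rewrite ler_pdivrMr ?mul1r// lt_neqAle eq_sym rx0 r0.
  (* Where r vanishes so does h, and both sides are 0. *)
  - move=> x; rewrite /phi /e /= -mulrA -rmorphM/=; have [rx0|rx0] := eqVneq (r x) 0.
      have : normc (h x) = 0 by apply/le_anti; rewrite normc_ge0 andbT -rx0.
      by move/eq0_normc ->; rewrite mul0r.
    by rewrite mulVf// mulr1.
have [|mp p1 fE] := quo f; first by move=> x; rewrite lerDl normc_ge0.
have [|mq q1 gE] := quo g; first by move=> x; rewrite lerDr normc_ge0.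
set p := (fun x => f x * _) in mp p1 fE; set q := (fun x => g x * _) in mq q1 gE.
set a := repr (A1 (\pi_(L2 mu) e)); set b := repr (A2 (\pi_(L2 mu) e)).
have L (phi : X -> R[i]) (h : L2fun mu) : cmeasurable phi -> (forall x, normc (phi x) <= 1) ->
    exists k : L2fun mu, forall x, k x = phi x * h x.
  move=> mphi phi1; have Lk := cLfun_mul mphi (aeW _ phi1) (L2funP h).
  by exists (MkL2fun Lk).
have [pa paE] := L _ a mp p1; have [pb pbE] := L _ b mp p1.
have [qa qaE] := L _ a mq q1; have [qb qbE] := L _ b mq q1.
rewrite (modulus_mul iT1 hA1 mp p1 fE paE) (modulus_mul iT2 hA2 mp p1 fE pbE).
rewrite (modulus_mul iT1 hA1 mq q1 gE qaE) (modulus_mul iT2 hA2 mq q1 gE qbE).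
rewrite !dotL2E; apply: ae_eq_cintegral.
- by apply: cmeasurableM; [|apply: cmeasurable_conj]; exact: L2fun_measurable.
- by apply: cmeasurableM; [|apply: cmeasurable_conj]; exact: L2fun_measurable.
have eR x : (e x)^*%C = e x by rewrite /e /= oppr0.
apply: filterS2 (modulus_real iT1 hA1 eR) (modulus_real iT2 hA2 eR) => x ax bx _.
by rewrite paE pbE qaE qbE !rmorphM/= ax bx; ring.
Qed.

Lemma induces_iter w (T : L2 mu -> L2 mu) n :
  induces w T -> induces (iter n w) (iter n T).
Proof.
move=> iT; elim: n => [|n IH] f; first by exists f.
have [g gE TgE] := IH f; have [h hE ThE] := iT g.
by exists h; rewrite /= ?hE ?gE// TgE.
Qed.

Lemma iter_wcomp xi psi n : exists xi' psi', iter n (wcomp xi psi) = wcomp xi' psi'.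
Proof.
elim: n => [|n [xi' [psi' IH]]].
  by exists (cst 1), id; apply/funext => f; apply/funext => x; rewrite /wcomp mul1r.
exists (fun x => xi x * xi' (psi x)), (psi' \o psi).
by apply/funext => f; apply/funext => x; rewrite iterS IH /wcomp mulrA.
Qed.

Lemma adjoint_iter (T S : L2 mu -> L2 mu) n : is_adjoint (dotL2 mu) T S ->
  is_adjoint (dotL2 mu) (iter n T) (iter n S).
Proof.
move=> TS; elim: n => [|n IH] u v //.
by rewrite iterS TS IH -iterSr.
Qed.

Lemma wcomp_half_centered xi psi (T : {linear L2 mu -> L2 mu}) :
  induces (wcomp xi psi) T -> bounded_op (dotL2 mu) T ->
  (forall v, exists w, forall u, dotL2 mu (T u) v = dotL2 mu u w) ->
  half_centered (dotL2 mu) T.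
Proof.
move=> iT bT /linear_of_adjoint[S TS]; split => //; exists S; split => // m n _ _.
have hM k : modulus_of (iter k T) (iter k S \o iter k T).
  move=> u v; rewrite /= dotL2_conj -(adjoint_iter k TS) -dotL2_conj //.
have [xm [pm Em]] := iter_wcomp xi psi m.
have [xn [pn En]] := iter_wcomp xi psi n.
have := induces_iter m iT; rewrite Em => im.
have := induces_iter n iT; rewrite En => i_n.
exact: modulus_commute im (hM m) i_n (hM n).
Qed.

End modulus.

Theorem proposition2p5 (R : realType) (d : measure_display)
    (X : measurableType d) (mu : {sigma_finite_measure set X -> \bar R})
    (psi : X -> X) (mpsi : measurable_fun setT psi)
    (hpsi : exists C : {linear L2 mu -> L2 mu},
        bounded_op (dotL2 mu) C /\ induces (fun f => f \o psi) C)
    (xi : X -> R[i]) (hxi : xi \in cLfun mu +oo%E) :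
  exists T : {linear L2 mu -> L2 mu},
    induces (fun f x => xi x * f (psi x)) T /\ half_centered (dotL2 mu) T.
Proof.
have [C [bC iC]] := hpsi; have [mxi [M xiM]] := cLfun_infty_bounded hxi.
have [N [iN bN aN]] := multiplication_operator mxi xiM.
have iT : induces (wcomp xi psi) (N \o C).
  move=> f; have [g gE CE] := iC f; have [h hE NE] := iN g.
  by exists h; [rewrite hE gE|rewrite /= CE].
exists (N \o C); split; first exact: iT.
apply: wcomp_half_centered iT _ _.
- have [K1 K10 h1] := (bounded_opP C).1 bC.
  have [K2 K20 h2] := (bounded_opP N).1 bN.
  apply/bounded_opP; exists (K2 * K1); first exact: mulr_gt0.
  move=> u; apply: le_trans (h2 _) _.
  by rewrite rmorphM -mulrA ler_pM2l// ltcR.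
- move=> v; have [w hw] := aN v; have [w' hw'] := composition_adjoint mpsi bC iC w.
  by exists w' => u; rewrite -hw'; exact: hw.
Qed.
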